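(* Let $H$ be a real separable Hilbert space, $d\in\mathbb N$, $d\ge1$, and let $\mu$ be a Borel probability measure on $H$ with bounded support and $\operatorname{diam}(\mu)>0$. If $\mu$ is $d$-separated for the positive constants $\omega$ and $\epsilon$, then $$e_2^2(\mu,d)\le \frac{1}{\omega^2\,\epsilon^{d+1}}\int_{H^{d+2}} c_{\mathrm{vol},\mu}^2(X)\,d\mu^{d+2}(X).$$
   Context: $\mathrm{AG}_d(H)$ is the set of $d$-dimensional affine subspaces of $H$ and $e_2(\mu,d)=\inf_{L\in\mathrm{AG}_d(H)}\sqrt{\int\operatorname{dist}^2(x,L)\,d\mu(x)}$. $\operatorname{supp}(\mu)$ is the support of $\mu$ and $\operatorname{diam}(\mu)$ its diameter. For $X=(x_0,\dots,x_n)\in H^{n+1}$, $\mathrm M_n(X)$ is the $n$-dimensional volume of any of the parallelotopes generated by the vertices of $X$, i.e. the square root of the Gram determinant of $x_1-x_0,\dots,x_n-x_0$. For $X\in H^{d+2}$, $c_{\mathrm{vol},\mu}(X)=\mathrm M_{d+1}(X)/\operatorname{diam}(\mu)^d$. The measure $\mu$ is $d$-separated for positive constants $\omega,\epsilon$ if there exist (Borel) sets $V_i\subseteq\operatorname{supp}(\mu)$, $0\le i\le d$, such that $\mu(V_i)\ge\epsilon$ for each $i$ and $\prod_{i=0}^d V_i\subseteq\{X\in\operatorname{supp}(\mu)^{d+1}:\mathrm M_d(X)\ge\omega\cdot\operatorname{diam}(\mu)^d\}$. *)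

(* Defs.v *)
From HB Require Import structures.
From mathcomp Require Import all_boot all_order all_algebra.
From mathcomp Require Import all_classical all_reals all_analysis.

Set Implicit Arguments.
Unset Strict Implicit.
Unset Printing Implicit Defensive.

Import Order.TTheory GRing.Theory Num.Theory.
Import numFieldNormedType.Exports.

Local Open Scope classical_set_scope.
Local Open Scope ring_scope.

Definition separable (T : topologicalType) : Prop :=
  exists2 D : set T, countable D & dense D.

(* A real Hilbert space is given by a complete normed module [H] together with
   a symmetric positive definite form [dot : {dot H for idfun}] such that
   [inner_product_of_norm dot] holds. *)
Definition inner_product_of_norm (R : realType) (H : normedModType R)
    (dot : {dot H for idfun}) : Prop :=
  forall x : H, dot x x = `|x| ^+ 2.

Definition borel (T : ptopologicalType) := g_sigma_algebraType (@open T).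

Section product_probability.
Context d (T : measurableType d) (R : realType).

Definition tuple_cons n (x : T * n.-tuple T) : n.+1.-tuple T :=
  [tuple of x.1 :: x.2].

Lemma measurable_tuple_cons n : measurable_fun [set: T * n.-tuple T] (@tuple_cons n).
Proof. exact: measurable_cons measurable_fst measurable_snd. Qed.

HB.instance Definition _ n :=
  isMeasurableFun.Build _ _ _ _ (@tuple_cons n) (@measurable_tuple_cons n).

(* [power_measure mu n] is the n-fold product of [mu] on [T^n], carried by the
   product sigma-algebra on [n.-tuple T]; see [power_measure_box]. *)
Fixpoint power_measure (mu : probability T R) (n : nat) :
    probability (n.-tuple T) R :=
  match n with
  | 0 => \d_[tuple]
  | m.+1 => distribution (mu \x power_measure mu m)%E (@tuple_cons m)
  end.

Lemma measurable_box n (A : 'I_n -> set T) : (forall i, measurable (A i)) ->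
  measurable [set X : n.-tuple T | forall i, A i (tnth X i)].
Proof.
move=> mA; rewrite (_ : [set _ | _] =
  \bigcap_(i in [set: 'I_n]) ((@tnth n T)^~ i @^-1` A i)); last first.
  by apply/seteqP; split => X /= AX i; [move=> _|]; exact: AX.
apply: fin_bigcap_measurable => // i _.
by rewrite -[X in measurable X]setTI; exact: measurable_tnth.
Qed.

Lemma power_measure_box (mu : probability T R) n (A : 'I_n -> set T) :
  (forall i, measurable (A i)) ->
  power_measure mu n [set X | forall i, A i (tnth X i)] =
    (\prod_(i < n) mu (A i))%E.
Proof.
elim: n A => [|n IH] A mA.
  rewrite big_ord0 /= diracE mem_set//= => -[].
  by [].
rewrite big_ord_recl -IH => [|i]; last exact: mA.
rewrite -(product_measure1E mu (power_measure mu n)) //; last first.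
  exact: (measurable_box (A := fun i => A (lift ord0 i))) (fun i => mA _).
rewrite /= /distribution /pushforward; congr (_ _).
apply/seteqP; split=> [[x X] /= AX|[x X] /= [Ax AX] i].
  split; first exact: (AX ord0).
  by move=> i; have := AX (lift ord0 i); rewrite /tuple_cons tnthS.
have [->//|i0] := eqVneq i ord0.
have [j ->] : exists j, i = lift ord0 j.
  by case: (unliftP ord0 i) i0 => [j ->|->]; [exists j|rewrite eqxx].
by rewrite /tuple_cons tnthS.
Qed.

End product_probability.

Section affine.
Context (R : realType) (H : normedModType R).

Definition lin_indep n (v : 'I_n -> H) : Prop :=
  forall a : 'I_n -> R, \sum_(i < n) a i *: v i = 0 -> forall i, a i = 0.

Definition affine_span n (p : H) (v : 'I_n -> H) : set H :=
  [set p + \sum_(i < n) a i *: v i | a in [set: 'I_n -> R]].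

Definition AG (d : nat) : set (set H) :=
  [set L | exists p (v : 'I_d -> H), lin_indep v /\ L = affine_span p v].

Definition dist (x : H) (L : set H) : R := inf [set `|x - y| | y in L].

End affine.

Section measure.
Context (R : realType) (H : normedModType R) (mu : probability (borel H) R).

Definition supp : set H :=
  [set x | forall U : set H, open U -> U x -> (0 < mu U)%E].

(* The real [sup] is the diameter only when the support is bounded; it is 0 by
   convention otherwise. *)
Definition diam : R := sup [set `|x - y| | x in supp & y in supp].

(* Extended real valued, with value [+oo] when [H] has dimension less than [d]
   so that [AG d] is empty. *)
Definition e2 (d : nat) : \bar R :=
  ereal_inf [set sqrte (\int[mu]_x (dist x L ^+ 2)%:E)%E | L in @AG R H d].

End measure.

Section volume.
Context (R : realType) (H : normedModType R) (dot : {dot H for idfun}).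

Definition gram_volume n (X : n.+1.-tuple H) : R :=
  let v (i : 'I_n) := tnth X (lift ord0 i) - tnth X ord0 in
  Num.sqrt (\det (\matrix_(i < n, j < n) dot (v i) (v j))).

Definition c_vol (mu : probability (borel H) R) d (X : d.+2.-tuple H) : R :=
  gram_volume X / diam mu ^+ d.

Definition d_separated (mu : probability (borel H) R) (d : nat) (omega eps : R) :
    Prop :=
  exists V : 'I_d.+1 -> set (borel H),
    [/\ forall i, measurable (V i),
        forall i, V i `<=` supp mu,
        forall i, (eps%:E <= mu (V i))%E &
        [set X : d.+1.-tuple H | forall i, V i (tnth X i)] `<=`
        [set X | (forall i, supp mu (tnth X i)) /\
                 omega * diam mu ^+ d <= gram_volume X]].

End volume.

(* Main.v *)
(* The squared volume of the parallelotope on x and X = (x_0, ..., x_d) is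
   |x - y|^2 M_d(X)^2, where y is the orthogonal projection of x on the affine
   span L of X.  When X lies in the box V_0 x ... x V_d, this is at least
   dist(x, L)^2 omega^2 diam(mu)^(2d), so integrating over x bounds the inner
   integral of c_vol^2 below by omega^2 e2(mu, d)^2; integrating over the box
   then contributes the factor mu(V_0) ... mu(V_d) >= eps^(d+1). *)
Require Import Defs.
From HB Require Import structures.
From mathcomp Require Import all_boot all_order all_algebra.
From mathcomp Require Import all_classical all_reals all_analysis.
From mathcomp Require Import measurable_realfun ring lra.

Set Implicit Arguments.
Unset Strict Implicit.
Unset Printing Implicit Defensive.

Import Order.TTheory GRing.Theory Num.Theory.
Import numFieldNormedType.Exports.

Local Open Scope classical_set_scope.
Local Open Scope ring_scope.

(** * Gram determinants, changes of edges and orthogonal projection *)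

Section gram.
Context (R : realType) (H : normedModType R) (dot : {dot H for idfun}).

Definition gram n (v : 'I_n -> H) : 'M[R]_n := \matrix_(i, j) dot (v i) (v j).

Definition lincomb m n (A : 'M[R]_(m, n)) (v : 'I_n -> H) (i : 'I_m) : H :=
  \sum_(j < n) A i j *: v j.

Lemma dotC (x y : H) : dot x y = dot y x.
Proof. by rewrite hermC expr0 mul1r. Qed.

Lemma dot_polarization (x y : H) : dot x y = (dot x x + dot y y - dot (x - y) (x - y)) / 2.
Proof.
have -> : dot (x - y) (x - y) = dot x x - dot x y *+ 2 + dot y y.
  by rewrite linearBr !linearBl /= (dotC y x); ring.
by field.
Qed.

(** Bilinearity. For square [A], taking determinants shows that a change of edges with determinant 1
    or -1 preserves the volume. *)
Lemma gram_lincomb m n (A : 'M[R]_(m, n)) v :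
  gram (lincomb A v) = A *m gram v *m A^T.
Proof.
apply/matrixP => i j; rewrite !mxE /lincomb linear_sumr.
apply: eq_bigr => l _; rewrite linear_sumlz !mxE mulr_suml.
apply: eq_bigr => k _.
by rewrite linearZl_LR linearZr_LR /= !mxE -mulrA [dot _ _ * _]mulrC.
Qed.

(** Pairing a vanishing combination with each [v j] puts its coefficient row in the kernel of the
    invertible Gram matrix. *)
Lemma lin_indep_gram n (v : 'I_n -> H) : \det (gram v) != 0 -> lin_indep v.
Proof.
move=> G0 a av0 i; suff: \row_j a j = 0 by move/rowP/(_ i); rewrite !mxE.
apply: (row_free_inj (A := gram v)); first by rewrite row_free_unit unitmxE unitfE.
rewrite mul0mx; apply/rowP => j; rewrite !mxE.
under eq_bigr do rewrite !mxE -linearZl_LR.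
by rewrite -linear_sumlz av0 linear0l.
Qed.

(** The index type ['I_(1 + n)] lets Gram matrices and changes of edges be written with
    [block_mx]. *)
Definition fcons n (u : H) (w : 'I_n -> H) (k : 'I_(1 + n)) : H :=
  match fintype.split k with inl _ => u | inr j => w j end.

(** Squared height times squared base volume: orthogonality makes the Gram matrix block diagonal. *)
Lemma det_gram_fcons n (u : H) (w : 'I_n -> H) : (forall j, dot u (w j) = 0) ->
  \det (gram (fcons u w)) = dot u u * \det (gram w).
Proof.
move=> uw; rewrite (_ : gram _ = block_mx (dot u u)%:M 0 0 (gram w)).
  by rewrite det_lblock det_scalar expr1.
apply/matrixP => i j; rewrite !mxE /fcons.
case: fintype.split => [i'|i']; rewrite !mxE; case: fintype.split => j'; rewrite !mxE //.
  by rewrite !ord1 eqxx.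
by rewrite dotC.
Qed.

Lemma fconsl n u (w : 'I_n -> H) k : fcons u w (lshift n k) = u.
Proof. by rewrite /fcons (unsplitK (inl _)). Qed.

Lemma fconsr n u (w : 'I_n -> H) k : fcons u w (rshift 1 k) = w k.
Proof. by rewrite /fcons (unsplitK (inr _)). Qed.

(** A shear parallel to the base: the change of edges is unitriangular. *)
Lemma det_gram_fcons_translate n (u : H) (w : 'I_n -> H) (a : 'I_n -> R) :
  \det (gram (fcons (u + \sum_(j < n) a j *: w j) w)) = \det (gram (fcons u w)).
Proof.
set A := block_mx (1%:M : 'M[R]_1) (\row_j a j) 0 1%:M.
rewrite (_ : fcons (_ + _) _ = lincomb A (fcons u w)).
  by rewrite gram_lincomb !det_mulmx det_tr det_ublock !det1 !mul1r mulr1.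
apply/funext => k; rewrite /lincomb big_split_ord/= big_ord_recl big_ord0 addr0.
rewrite fconsl -(splitK k); case: fintype.split => i/=.
  rewrite fconsl block_mxEul !mxE !ord1 eqxx scale1r; congr (_ + _).
  by apply: eq_bigr => j _; rewrite fconsr block_mxEur mxE.
rewrite fconsr block_mxEdl !mxE scale0r add0r (bigD1 i)//= big1 => [|j ji].
  by rewrite block_mxEdr mxE eqxx scale1r fconsr addr0.
by rewrite block_mxEdr mxE eq_sym (negbTE ji) scale0r.
Qed.

(* With [x], [p] and the [p + w j] as vertices and [z = x - p], the edges are
   taken from [x] on the left and from [p] on the right. *)
Lemma det_gram_rebase n (z : H) (w : 'I_n -> H) :
  \det (gram (fcons (- z) (fun j => w j - z))) = \det (gram (fcons z w)).
Proof.
(* [A] has determinant -1, which enters squared through [A] and its transpose. *)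
pose A := block_mx (- 1%:M : 'M[R]_1) 0 (const_mx (-1) : 'cV_n) 1%:M.
rewrite (_ : fcons (- z) _ = lincomb A (fcons z w)).
  rewrite gram_lincomb !det_mulmx det_tr det_lblock det1 det_mx11 !mxE eqxx.
  by rewrite mulr1 mulN1r mulrN1 opprK.
apply/funext => k; rewrite /lincomb big_split_ord/= big_ord_recl big_ord0 addr0.
rewrite fconsl -(splitK k); case: fintype.split => i/=.
  rewrite fconsl block_mxEul !mxE !ord1 eqxx scaleN1r big1 ?addr0// => j _.
  by rewrite block_mxEur mxE scale0r.
rewrite fconsr block_mxEdl !mxE scaleN1r addrC; congr (_ + _).
rewrite (bigD1 i)//= big1 => [|j ji].
  by rewrite block_mxEdr mxE eqxx scale1r fconsr addr0.
by rewrite block_mxEdr mxE eq_sym (negbTE ji) scale0r.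
Qed.

Lemma orthogonal_projection n (w : 'I_n -> H) (z : H) : \det (gram w) != 0 ->
  exists a : 'I_n -> R, forall k, dot (z - \sum_(j < n) a j *: w j) (w k) = 0.
Proof.
move=> G0; have Gu : gram w \in unitmx by rewrite unitmxE unitfE.
(* The coefficients solve the normal equations: the row [a] satisfies [a *m gram w = b]. *)
pose b := \row_k dot z (w k); exists (fun j => (b *m invmx (gram w)) 0 j) => k.
rewrite linearBl linear_sumlz; apply/eqP; rewrite subr_eq0; apply/eqP.
transitivity (b 0 k); first by rewrite mxE.
rewrite -[in LHS](mulmxKV Gu b) mxE; apply: eq_bigr => j _.
by rewrite linearZl_LR /= [gram w j k]mxE.
Qed.

(* [y] is the orthogonal projection of [x] on the affine span of [X]. *)
Lemma gram_volume_cons (H_dot : inner_product_of_norm dot) n (x : H) (X : n.+1.-tuple H) :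
  let w (i : 'I_n) := tnth X (lift ord0 i) - tnth X ord0 in
  0 < gram_volume dot X ->
  exists2 y, affine_span (tnth X ord0) w y &
    gram_volume dot [tuple of x :: X] = `|x - y| * gram_volume dot X.
Proof.
move=> w; rewrite {1 3}/gram_volume -/(gram w) sqrtr_gt0 => G0.
have [a aw] := @orthogonal_projection n w (x - tnth X ord0) (lt0r_neq0 G0).
exists (tnth X ord0 + \sum_(j < n) a j *: w j); first by exists a.
set u := _ - \sum_(j < n) _ in aw; rewrite opprD addrA -/u.
rewrite -(ger0_norm (normr_ge0 u)) -sqrtr_sqr -sqrtrM ?sqr_ge0// -H_dot.
(* From the height [u], adding back the projection gives the edge [x - tnth X ord0]; rebasing then
   gives the edges issued from [x]. *)
rewrite -det_gram_fcons// -(det_gram_fcons_translate _ _ a) subrK -det_gram_rebase.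
rewrite /gram_volume; congr (Num.sqrt (\det (gram _))).
apply/funext => k; rewrite tnthS tnth0 -(@splitK 1 n k).
case: fintype.split => i/=.
  by rewrite fconsl opprB ord1 lshift0.
by rewrite fconsr rshift1 /w opprB addrA subrK.
Qed.

End gram.

(** * Borel measurability of distances and volumes *)

Section measurability.
Context (R : realType) (H : normedModType R).

Lemma measurable_fun_open_sublevel (f : H -> R) :
  (forall r, open [set x | f x < r]) -> measurable_fun [set: borel H] f.
Proof.
move=> fo; apply: (measurability _ (RGenInftyO.measurableE R)).
move=> _ [_ [r ->] <-]; rewrite setTI; apply: sub_sigma_algebra.
rewrite (_ : f @^-1` _ = [set x | f x < r]); first exact: fo.
by apply/seteqP; split => x /=; rewrite in_itv.
Qed.

Lemma measurable_dist (L : set H) : L !=set0 ->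
  measurable_fun [set: borel H] (fun x => dist x L).
Proof.
move=> [z Lz]; apply: measurable_fun_open_sublevel => r.
(* The infimum is below [r] exactly when some point of [L] is within [r] of [x]. *)
rewrite (_ : [set _ | _] = \bigcup_(y in L) ball y r).
  by apply: bigcup_open => y _; exact: ball_open.
apply/seteqP; split => x /=; last first.
  move=> [y Ly]; rewrite -ball_normE/= distrC; apply: le_lt_trans.
  by apply: ge_inf; [exists 0 => _ [t _ <-]|exists y].
move=> /inf_lt[]; first by exists `|x - z|; exists z.
by move=> _ [y Ly <-] yr; exists y; rewrite // -ball_normE/= distrC.
Qed.

(* Separability is what makes the distance jointly measurable for the product
   of the Borel sigma-algebras: [|x - y| < r] holds iff [|x - q| + |y - q| < r]
   for some [q] in a countable dense set. *)
Lemma measurable_norm_sub (H_separable : separable H) :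
  measurable_fun [set: borel H * borel H] (fun z => `|z.1 - z.2 : H| : R).
Proof.
have mN (q : H) : measurable_fun [set: borel H] (fun x : H => `|x - q| : R).
  apply: measurable_fun_open_sublevel => r.
  rewrite (_ : [set _ | _] = ball q r); first exact: ball_open.
  by apply/seteqP; split => x /=; rewrite -ball_normE/= distrC.
have [D cD dD] := H_separable.
apply: (measurability _ (RGenInftyO.measurableE R)).
move=> _ [_ [r ->] <-]; rewrite setTI.
rewrite (_ : _ @^-1` _ =
  \bigcup_(q in D) [set z : borel H * borel H | `|z.1 - q : H| + `|z.2 - q : H| < r]); last first.
  apply/seteqP; split => -[x y] /=; rewrite in_itv/=.
    (* Half the slack suffices: the sum of distances to [q] is at most [|x - y|] plus twice
       [|x - q|]. *)
    move=> xyr; pose e := (r - `|x - y|) / 2.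
    have e0 : 0 < e by rewrite divr_gt0// subr_gt0.
    have [|q [xq Dq]] := dD (ball x e) _ (ball_open _ _).
      by exists x; exact: ballxx.
    exists q => //=; move: xq; rewrite -ball_normE/= => xq.
    have := ler_distD x y q; rewrite [`|y - x|]distrC /e in xq *; lra.
  by move=> [q Dq] /=; apply: le_lt_trans; rewrite [`|y - q|]distrC ler_distD.
rewrite bigcup_set_type; apply: countable_bigcupT_measurable.
  by rewrite (eq_countable (card_setT _)).
move=> q; rewrite -[X in measurable X]setTI.
pose f (z : borel H * borel H) : R := `|z.1 - val q : H| + `|z.2 - val q : H|.
have mf : measurable_fun setT f.
  by apply: measurable_funD; apply: measurableT_comp (mN _) _.
rewrite [X in _ `&` X](_ : _ = f @^-1` `]-oo, r[%classic).
  by apply: mf.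
by apply/seteqP; split => z /=; rewrite in_itv.
Qed.

(* By polarization, the Gram matrix only involves distances between vertices,
   so no measurability of the sum of two vectors is needed. *)
Lemma measurable_gram_volume (dot : {dot H for idfun}) (H_dot : inner_product_of_norm dot)
    (H_separable : separable H) n :
  measurable_fun [set: n.+1.-tuple (borel H)] (@gram_volume R H dot n).
Proof.
have mX (i j : 'I_n.+1) :
    measurable_fun [set: n.+1.-tuple (borel H)] (fun X => `|tnth X i - tnth X j : H| ^+ 2 : R).
  apply: measurable_funX.
  apply: (measurableT_comp (measurable_norm_sub H_separable) (g := fun X => (tnth X i, tnth X j))).
  by apply: measurable_fun_pair; exact: measurable_tnth.
have mdot (i j : 'I_n) : measurable_fun [set: n.+1.-tuple (borel H)] (fun X =>
    dot (tnth X (lift ord0 i) - tnth X ord0) (tnth X (lift ord0 j) - tnth X ord0) : R).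
  rewrite (_ : (fun _ => _) = (fun X : n.+1.-tuple H =>
     (`|tnth X (lift ord0 i) - tnth X ord0| ^+ 2 + `|tnth X (lift ord0 j) - tnth X ord0| ^+ 2
       - `|tnth X (lift ord0 i) - tnth X (lift ord0 j)| ^+ 2) * 2^-1)).
    apply: measurable_funM => //; apply: measurable_funB; first exact: measurable_funD.
    exact: mX.
  apply/funext => X; rewrite -!H_dot.
  set p := tnth X ord0; set x := tnth X (lift ord0 i); set y := tnth X (lift ord0 j).
  have -> : x - y = (x - p) - (y - p) by rewrite opprB addrA subrK.
  exact: dot_polarization.
apply: (measurableT_comp (f := @Num.sqrt R)).
  by apply: continuous_measurable_fun; exact: sqrt_continuous.
(* Leibniz expansion of the determinant over permutations [s]. *)
apply: measurable_sum => s; apply: measurable_funM => //.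
apply: measurable_prod => i _.
under eq_fun do rewrite mxE.
exact: mdot.
Qed.

End measurability.

(** * The least-squares error and the distance to a subspace *)

Section least_squares.
Context (R : realType) (H : normedModType R) (mu : probability (borel H) R).

Lemma e2_ge0 d : (0 <= e2 mu d)%E.
Proof. by apply: le_ereal_inf_tmp => _ [L _ <-]; exact: sqrte_ge0. Qed.

Lemma e2_sqr_le d (L : set H) : AG d L ->
  (e2 mu d ^+ 2 <= \int[mu]_x (dist x L ^+ 2)%:E)%E.
Proof.
move=> dL; have I0 : (0 <= \int[mu]_x (dist x L ^+ 2)%:E)%E.
  by apply: integral_ge0 => x _; rewrite lee_fin sqr_ge0.
rewrite -[leRHS](sqr_sqrte I0) lee_sqr ?e2_ge0 ?sqrte_ge0//.
by apply: ereal_inf_lbound; exists L.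
Qed.

Lemma dist_ge0 (x : H) (L : set H) : 0 <= dist x L.
Proof.
(* For empty [L] the infimum takes its default value 0. *)
have [->|/set0P L0] := eqVneq L set0; first by rewrite /dist image_set0 inf0.
apply: lb_le_inf; last by move=> _ [y _ <-].
by case: L0 => y Ly; exists `|x - y|; exists y.
Qed.

Lemma dist_le (x y : H) (L : set H) : L y -> dist x L <= `|x - y|.
Proof. by move=> Ly; apply: ge_inf; [exists 0 => _ [t _ <-]|exists y]. Qed.

End least_squares.

(** * Boxes and iterated integrals for the power measure *)

Lemma power_measure_box_ge d (T : measurableType d) (R : realType)
    (mu : probability T R) n (A : 'I_n -> set T) (eps : R) : 0 <= eps ->
  (forall i, measurable (A i)) -> (forall i, (eps%:E <= mu (A i))%E) ->
  ((eps ^+ n)%:E <= power_measure mu n [set X | forall i, A i (tnth X i)])%E.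
Proof.
move=> eps0 mA epsA; rewrite power_measure_box//.
have muA i : mu (A i) = (fine (mu (A i)))%:E by rewrite fineK// fin_num_measure.
under eq_bigr do rewrite muA.
rewrite prodEFin lee_fin -[in leLHS](card_ord n) -prodr_const.
by apply: ler_prod => i _; rewrite eps0 -lee_fin -muA epsA.
Qed.

(** Change of variables along [tuple_cons], then Tonelli; the head vertex is integrated innermost,
    so that the other vertices can be fixed in a box. *)
Lemma integral_power_measureS d (T : measurableType d) (R : realType)
    (mu : probability T R) n (f : n.+1.-tuple T -> \bar R) :
  measurable_fun setT f -> (forall X, 0 <= f X)%E ->
  (\int[power_measure mu n.+1]_X f X =
   \int[power_measure mu n]_X \int[mu]_x f (tuple_cons (x, X)))%E.
Proof.
move=> mf f0.
rewrite ge0_integral_pushforward//.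
rewrite preimage_setT fubini_tonelli2// => [|x]; last exact: f0.
by apply: measurableT_comp => //; exact: measurable_tuple_cons.
Qed.

Theorem theorem5p1 (R : realType) (H : completeNormedModType R)
    (dot : {dot H for idfun}) (H_hilbert : inner_product_of_norm dot)
    (H_separable : separable H)
    (d : nat) (d_ge1 : (1 <= d)%N)
    (mu : probability (borel H) R)
    (supp_bounded : bounded_set (supp mu)) (diam_gt0 : 0 < diam mu)
    (omega eps : R) (omega_gt0 : 0 < omega) (eps_gt0 : 0 < eps)
    (mu_separated : d_separated dot mu d omega eps) :
  (e2 mu d ^+ 2 <=
     (1 / (omega ^+ 2 * eps ^+ d.+1))%:E *
     \int[power_measure mu d.+2]_X (c_vol dot mu X ^+ 2)%:E)%E.
Proof.
have [V [mV _ Veps Vvol]] := mu_separated.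
pose box := [set X : d.+1.-tuple (borel H) | forall i, V i (tnth X i)].
have mbox : measurable box by exact: measurable_box.
pose f (X : d.+2.-tuple (borel H)) := (c_vol dot mu X ^+ 2)%:E.
have mf : measurable_fun setT f.
  apply/measurable_EFinP; apply: measurable_funX; apply: measurable_funM => //.
  exact: measurable_gram_volume.
have f0 X : (0 <= f X)%E by rewrite lee_fin sqr_ge0.
have mfcons : measurable_fun setT (f \o @tuple_cons _ (borel H) d.+1).
  by apply: measurableT_comp => //; exact: measurable_tuple_cons.
have fiber X : box X ->
    ((omega ^+ 2)%:E * e2 mu d ^+ 2 <= \int[mu]_x f (tuple_cons (x, X)))%E.
  move=> /Vvol[_ volX].
  have gX : 0 < gram_volume dot X.
    by apply: lt_le_trans volX; rewrite mulr_gt0// exprn_gt0.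
  pose w (i : 'I_d) := (tnth X (lift ord0 i) - tnth X ord0 : H).
  pose L := affine_span (tnth X ord0 : H) w.
  have L0 : L !=set0 by eexists; exists (fun=> 0).
  (* [L] has dimension exactly [d]: positive volume makes the Gram determinant nonzero, hence the
     edges independent. *)
  have dL : AG d L.
    exists (tnth X ord0), w; split => //; apply: (lin_indep_gram (dot := dot)).
    by apply: lt0r_neq0; rewrite -sqrtr_gt0.
  have mL : measurable_fun [set: borel H] (fun x => (dist x L ^+ 2)%:E).
    by apply/measurable_EFinP; apply: measurable_funX; exact: measurable_dist.
  apply: (@le_trans _ _ ((omega ^+ 2)%:E * \int[mu]_x (dist x L ^+ 2)%:E)%E).
    by apply: lee_wpmul2l; [rewrite lee_fin sqr_ge0|exact: e2_sqr_le].
  rewrite -ge0_integralZl//; last 2 first.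
  - by move=> x _; rewrite lee_fin sqr_ge0.
  - by rewrite lee_fin sqr_ge0.
  apply: ge0_le_integral => //.
  - by move=> x _; rewrite -EFinM lee_fin mulr_ge0 ?sqr_ge0.
  - exact: measurable_funeM.
  - exact: measurable_fun_pair1 mfcons.
  move=> x _; rewrite -EFinM lee_fin -exprMn.
  have [y Ly volxX] := gram_volume_cons H_hilbert x gX.
  have c_ge0 : 0 <= c_vol dot mu (tuple_cons (x, X)).
    by rewrite divr_ge0 ?sqrtr_ge0// exprn_ge0// ltW.
  have lhs_ge0 : 0 <= omega * dist x L by rewrite mulr_ge0 ?dist_ge0// ltW.
  rewrite ler_pXn2r//.
  rewrite /c_vol volxX -mulrA mulrC ler_pM ?dist_ge0 ?(ltW omega_gt0) ?dist_le//.
  by rewrite ler_pdivlMr// exprn_gt0.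
have G0 X : (0 <= \int[mu]_x f (tuple_cons (x, X)))%E by apply: integral_ge0.
(* Tonelli also makes the inner integral measurable in [X], as comparing integrals over the box
   requires. *)
have mG := measurable_fun_fubini_tonelli_G (m1 := mu) _ mfcons (fun=> f0 _).
have c_gt0 : 0 < omega ^+ 2 * eps ^+ d.+1 by rewrite mulr_gt0// exprn_gt0.
rewrite div1r lee_pdivlMl// integral_power_measureS//.
apply: (@le_trans _ _ (\int[power_measure mu d.+1]_(X in box) ((omega ^+ 2)%:E * e2 mu d ^+ 2))%E).
  rewrite integral_cst// EFinM muleAC lee_wpmul2l//.
    by rewrite mule_ge0// ?lee_fin ?sqr_ge0// expe_ge0// e2_ge0.
  by apply: power_measure_box_ge => //; exact: ltW.
apply: (@le_trans _ _ (\int[power_measure mu d.+1]_(X in box) \int[mu]_x f (tuple_cons (x, X)))%E).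
  apply: ge0_le_integral => //.
  - by move=> X _; rewrite mule_ge0// ?lee_fin ?sqr_ge0// expe_ge0// e2_ge0.
  - exact: measurable_funTS mG.
(* Nonnegativity allows enlarging the box to the whole space. *)
exact: ge0_subset_integral.
Qed.
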